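(* Let $n>m$, let $\mathsf{A}\in\mathbb{R}^{n\times m}$ have full rank $m$, and let $D$ be the KL divergence, $D(\rho_y,\rho_y^* )=\int\rho_y\log\frac{\rho_y}{\rho_y^*}\,\mathrm{d}y$. Let $\rho_u^\infty$ be the equilibrium solution to the Wasserstein gradient flow $$\partial_t\rho_u-\nabla_u\cdot\Big(\rho_u\nabla_u\frac{\delta E}{\delta\rho_u}\Big)=0,\qquad E(\rho_u)=D(\mathsf{A}_\sharp\rho_u,\rho_y^* ),$$ and let $\rho_y^\infty=\mathsf{A}_\sharp\rho_u^\infty$. Suppose that $\rho_y^*$ has the separable form $$\rho_y^*(y)=e^{f_1(y_{\mathsf{A}})}\,e^{f_2(y_{\mathsf{A}^\perp})},$$ where $y_{\mathsf{A}}=\mathsf{V}\mathsf{V}^\top y$, the columns of $\mathsf{V}\in\mathbb{R}^{n\times m}$ being an orthonormal basis of the column space of $\mathsf{A}$, and $y_{\mathsf{A}^\perp}=y-y_{\mathsf{A}}$. Then $$\rho_y^\infty(y)=(\mathsf{A}\mathsf{A}^\dagger)_\sharp\rho_y^*\propto e^{f_1(y_{\mathsf{A}})},$$ as a density on the range of $\mathsf{A}$.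
   Context: Probability densities and measures are denoted interchangeably; $u\in\mathbb{R}^m$, $y\in\mathbb{R}^n$. $\mathsf{A}_\sharp$ denotes push-forward under $u\mapsto\mathsf{A}u$, and $\mathsf{A}^\dagger=(\mathsf{A}^\top\mathsf{A})^{-1}\mathsf{A}^\top$, so $\mathsf{A}\mathsf{A}^\dagger=\mathsf{V}\mathsf{V}^\top$ is the orthogonal projection onto the column space of $\mathsf{A}$. $\frac{\delta E}{\delta\rho_u}$ is the first variation (Fréchet derivative) of $E$, with $E(\rho_u+\delta\rho_u)-E(\rho_u)=\int\frac{\delta E}{\delta\rho_u}\delta\rho_u\,\mathrm{d}u+$ higher-order terms for $\int\delta\rho_u\,\mathrm{d}u=0$; here $\frac{\delta E}{\delta\rho_u}(u)=\frac{\delta D}{\delta\rho_y}\big|_{\rho_y=\mathsf{A}_\sharp\rho_u}(\mathsf{A}u)$ with $\frac{\delta D}{\delta\rho_y}=\log\rho_y-\log\rho_y^*+1$. An equilibrium solution $\rho_u^\infty$ is a stationary state of the flow, satisfying $\nabla_u\frac{\delta E}{\delta\rho_u}\big|_{\rho_u^\infty}=0$ on the support of $\rho_u^\infty$. Since $\mathsf{A}_\sharp\rho_u$ is supported on the range of $\mathsf{A}$ (a proper subspace of $\mathbb{R}^n$), its density is understood as a function of $y_{\mathsf{A}}$ on the range of $\mathsf{A}$ (with respect to Lebesgue measure on that subspace), with no $y_{\mathsf{A}^\perp}$ component. *)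

(* Defs.v *)
From HB Require Import structures.
From mathcomp Require Import all_boot all_order all_algebra.
From mathcomp Require Import all_classical all_reals all_analysis.
From mathcomp Require Import measurable_realfun.
From mathcomp Require Import ring lra.
Set Implicit Arguments.
Unset Strict Implicit.
Unset Printing Implicit Defensive.
Import Order.TTheory GRing.Theory Num.Theory.
Import numFieldNormedType.Exports.
Local Open Scope classical_set_scope.
Local Open Scope ring_scope.

(* Mathcomp-analysis provides no measurable structure or Lebesgue measure on
   column vectors.  R^n gets the product sigma-algebra, as n-tuples do. *)
Definition measure_cV_display : measure_display.
Proof. exact: default_measure_display. Qed.

Section measurable_cV.
Context {R : realType} (n : nat).

Definition cV_coord (i : 'I_n) (x : 'cV[R]_n) : R := x i 0.

Let cV_set0 : g_sigma_preimage cV_coord set0.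
Proof. exact: sigma_algebra0. Qed.

Let cV_setC A : g_sigma_preimage cV_coord A -> g_sigma_preimage cV_coord (~` A).
Proof. exact: sigma_algebraC. Qed.

Let cV_bigcup (F : (set 'cV[R]_n)^nat) :
  (forall i, g_sigma_preimage cV_coord (F i)) ->
  g_sigma_preimage cV_coord (\bigcup_i (F i)).
Proof. exact: sigma_algebra_bigcup. Qed.

HB.instance Definition _ := @isMeasurable.Build measure_cV_display
  'cV[R]_n (g_sigma_preimage cV_coord) cV_set0 cV_setC cV_bigcup.

Lemma measurable_cV_coord i : measurable_fun [set: 'cV[R]_n] (cV_coord i).
Proof.
move=> _ Y mY; rewrite setTI; apply: sub_sigma_algebra => /=.
rewrite -bigcup_seq/=; exists i => /=; first by rewrite mem_index_enum.
by exists Y => //; rewrite setTI.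
Qed.

Lemma measurable_fun_cVP d (T : measurableType d) (f : T -> 'cV[R]_n) :
  measurable_fun [set: T] f <->
  forall i, measurable_fun [set: T] (fun t => f t i 0).
Proof.
split=> [mf i|mf].
  exact: (measurableT_comp (measurable_cV_coord i) mf).
have H : g_sigma_preimage (fun i => cV_coord i \o f) `<=` measurable.
  apply: smallest_sub; first exact: sigma_algebra_measurable.
  rewrite -bigcup_seq; apply: bigcup_sub => i _.
  by move=> A [B mB <-]; exact: mf.
move: H; rewrite g_sigma_preimage_comp => prefS.
by move=> _ A mA; apply: prefS; exists A.
Qed.

End measurable_cV.

Section lebesgue_cV.
Context {R : realType}.

Section step.
Variable n : nat.

Definition cV_cons (p : R * 'cV[R]_n) : 'cV[R]_n.+1 :=
  \col_(i < n.+1) oapp (fun j => p.2 j 0) p.1 (unlift ord0 i).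

Definition cV_uncons (x : 'cV[R]_n.+1) : R * 'cV[R]_n :=
  (x ord0 0, \col_(i < n) x (lift ord0 i) 0).

Lemma cV_consK : cancel cV_cons cV_uncons.
Proof.
case=> a x; congr pair; first by rewrite mxE unlift_none.
by apply/colP => i; rewrite !mxE liftK.
Qed.

Lemma measurable_cV_cons : measurable_fun [set: R * 'cV[R]_n] cV_cons.
Proof.
apply/measurable_fun_cVP => i.
under eq_fun do rewrite mxE.
case: unliftP => [j|] _ /=; last exact: measurable_fst.
exact: (measurableT_comp (measurable_cV_coord j) measurable_snd).
Qed.

Lemma measurable_cV_uncons : measurable_fun [set: 'cV[R]_n.+1] cV_uncons.
Proof.
apply/measurable_fun_pairP; split; first exact: (measurable_cV_coord ord0).
apply/measurable_fun_cVP => i /=.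
by under eq_fun do rewrite mxE; exact: (measurable_cV_coord (lift ord0 i)).
Qed.

Variable mu : {sigma_finite_measure set 'cV[R]_n -> \bar R}.

Definition lebesgue_cV_step : set 'cV[R]_n.+1 -> \bar R :=
  pushforward (lebesgue_measure \x mu)%E cV_cons.

Let lebesgue_cV_step0 : lebesgue_cV_step set0 = 0%E.
Proof. by rewrite /lebesgue_cV_step /pushforward preimage_set0 measure0. Qed.

Let lebesgue_cV_step_ge0 A : (0 <= lebesgue_cV_step A)%E.
Proof. by rewrite /lebesgue_cV_step /pushforward measure_ge0. Qed.

Let lebesgue_cV_step_sigma_additive : semi_sigma_additive lebesgue_cV_step.
Proof.
by apply: measure_semi_sigma_additive; exact: measurable_cV_cons.
Qed.

HB.instance Definition _ := isMeasure.Build _ _ _ lebesgue_cV_step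
  lebesgue_cV_step0 lebesgue_cV_step_ge0 lebesgue_cV_step_sigma_additive.

Let lebesgue_cV_step_sigma_finite : sigma_finite setT lebesgue_cV_step.
Proof.
have /sigma_finiteP[F [TF ndF Foo]] := sigma_finiteT (@lebesgue_measure R).
have /sigma_finiteP[G [TG ndG Goo]] := sigma_finiteT mu.
exists (fun k => cV_uncons @^-1` (F k `*` G k)).
  rewrite -preimage_bigcup (_ : \bigcup_i _ = setT) ?preimage_setT//.
  apply/seteqP; split=> // -[x y] _.
  have [i _ Fix] : (\bigcup_i F i) x by rewrite -TF.
  have [j _ Gjy] : (\bigcup_i G i) y by rewrite -TG.
  exists (maxn i j) => //; split.
  - by move: x Fix; exact/subsetPset/ndF/leq_maxl.
  - by move: y Gjy; exact/subsetPset/ndG/leq_maxr.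
move=> k; have [mF Fkoo] := Foo k; have [mG Gkoo] := Goo k; split.
  rewrite -[X in measurable X]setTI; apply: measurable_cV_uncons => //.
  exact: measurableX.
rewrite /lebesgue_cV_step /pushforward -comp_preimage.
rewrite (_ : _ \o _ = id) ?preimage_id; last by apply/funext; exact: cV_consK.
by rewrite product_measure1E// lte_mul_pinfty// ge0_fin_numE.
Qed.

HB.instance Definition _ := Measure_isSigmaFinite.Build _ _ _
  lebesgue_cV_step lebesgue_cV_step_sigma_finite.

End step.

Fixpoint lebesgue_cV (n : nat) : {sigma_finite_measure set 'cV[R]_n -> \bar R} :=
  if n is n'.+1 then lebesgue_cV_step (lebesgue_cV n') else dirac (0 : 'cV[R]_0).

Lemma lebesgue_cV_box n (A : 'I_n -> set R) : (forall i, measurable (A i)) ->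
  lebesgue_cV n [set x | forall i, A i (x i 0)] =
  (\prod_(i < n) lebesgue_measure (A i))%E.
Proof.
elim: n A => [|n IH] A mA /=.
  by rewrite big_ord0 diracE mem_set// => -[].
rewrite big_ord_recl -IH//= /lebesgue_cV_step /pushforward.
have mB : measurable [set x : 'cV[R]_n | forall i, A (lift ord0 i) (x i 0)].
  rewrite (_ : [set x | _] = \bigcap_(i in [set: 'I_n])
    (cV_coord i @^-1` A (lift ord0 i))).
    apply: fin_bigcap_measurable => // i _.
    by rewrite -[X in measurable X]setTI; exact: measurable_cV_coord.
  by apply/seteqP; split=> x /= H i; [move=> _; exact: H|exact: H].
rewrite -product_measure1E//; last exact: mA.
congr ((_ \x _)%E _); apply/seteqP; split=> -[a x] /=.
  move=> Aax; split; first by have := Aax ord0; rewrite mxE unlift_none.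
  by move=> i; have := Aax (lift ord0 i); rewrite mxE liftK.
by move=> [Aa Ax] i; rewrite mxE; case: unliftP => [j ->|->].
Qed.

End lebesgue_cV.

Section densities.
Local Open Scope ereal_scope.
Context {d} {T : measurableType d} {R : realType}.
Implicit Types (mu : set T -> \bar R) (rho rho_star : T -> R).

Definition density_measure mu rho : set T -> \bar R :=
  fun B => \int[mu]_(x in B) (rho x)%:E.

Definition prob_density mu rho :=
  [/\ measurable_fun setT rho, (forall x, (0 <= rho x)%R)
    & \int[mu]_x (rho x)%:E = 1].

Definition KL mu rho rho_star : \bar R :=
  \int[mu]_x (rho x * ln (rho x / rho_star x))%:E.

(* [lne 0 = -oo]: the variation is infinite exactly where [rho] vanishes (for
   [rho_star > 0]), whereas the real logarithm has the junk value [ln 0 = 0]. *)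
Definition KL_variation rho rho_star (x : T) : \bar R :=
  lne (rho x)%:E - lne (rho_star x)%:E + 1.

End densities.

Section KL_first_variation.
Context {d} {T : measurableType d} {R : realType}.
Variable mu : {measure set T -> \bar R}.
Implicit Types rho rho_star h : T -> R.

Let xlnx_bound (x : R) : -1 < x ->
  0 <= (1 + x) * ln (1 + x) - x <= x ^+ 2.
Proof.
move=> x1; have x0 : 0 < 1 + x by lra.
have ub : ln (1 + x) <= x by exact: le_ln1Dx.
have lb : - ln (1 + x) <= (1 + x)^-1 - 1.
  rewrite -lnV ?posrE// -{1}[(1 + x)^-1](subrKC 1).
  by rewrite le_ln1Dx// ltrBrDl subrr invr_gt0.
have : (1 + x) * - ln (1 + x) <= (1 + x) * ((1 + x)^-1 - 1) by rewrite ler_pM2l.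
rewrite mulrBr divff ?gt_eqF// => lb'.
have : (1 + x) * ln (1 + x) <= (1 + x) * x by rewrite ler_pM2l.
by move=> ub'; apply/andP; split; nra.
Qed.

(* [KL_variation rho rho_star] is the first variation of [KL mu ^~ rho_star]
   at [rho], the remainder being quadratic. *)
Lemma KL_first_variation rho rho_star h (C e : R) :
  measurable_fun setT rho -> measurable_fun setT rho_star ->
  measurable_fun setT h ->
  (forall x, 0 <= rho x) -> (forall x, 0 < rho_star x) ->
  (forall x, `|h x| <= C * rho x) -> `|e| * C < 1 ->
  mu.-integrable setT (EFin \o rho) ->
  mu.-integrable setT (fun x => (rho x * ln (rho x / rho_star x))%:E) ->
  exists2 rem : R, `|rem| <= (e * C) ^+ 2 * \int[mu]_x rho x &
  (KL mu (fun x => rho x + e * h x)%R rho_star = KL mu rho rho_star +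
   e%:E * \int[mu]_x ((h x)%:E * KL_variation rho rho_star x) + rem%:E)%E.
Proof.
move=> mrho mstar mh rho0 star0 hC eC irho iKL.
pose k x := rho x * ln (rho x / rho_star x).
pose p x := h x * (ln (rho x) - ln (rho_star x) + 1).
pose q x := (rho x + e * h x) * ln ((rho x + e * h x) / rho_star x).
pose g x := q x - k x - e * p x.
have h0 x : rho x = 0 -> h x = 0.
  by move=> r0; apply/eqP; rewrite -normr_le0 (le_trans (hC x))// r0 mulr0.
have pE x : ((h x)%:E * KL_variation rho rho_star x)%E = (p x)%:E.
  rewrite /KL_variation /p; have [r0|r0] := eqVneq (rho x) 0.
    by rewrite h0// mul0r mul0e.
  by rewrite !lne_EFin// lt_neqAle eq_sym r0 rho0.
have gb x : `|g x| <= (e * C) ^+ 2 * rho x.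
  rewrite /g /q /k /p; have [r0|r0] := eqVneq (rho x) 0.
    by rewrite h0// r0 !(mulr0, mul0r, addr0, subrr) normr0.
  have rp : 0 < rho x by rewrite lt_neqAle eq_sym r0 rho0.
  set s := rho_star x; have sp : 0 < s := star0 x.
  pose y := e * h x / rho x.
  have yC : `|y| <= `|e| * C.
    rewrite /y !normrM normfV (gtr0_norm rp) -mulrA ler_wpM2l//.
    by rewrite ler_pdivrMr.
  have y1 : -1 < y by have := le_lt_trans yC eC; rewrite ltr_norml => /andP[].
  have y0 : 0 < 1 + y by lra.
  have -> : rho x + e * h x = rho x * (1 + y) by rewrite /y; field.
  have -> : e * (h x * (ln (rho x) - ln s + 1)) =
            rho x * y * (ln (rho x) - ln s + 1) by rewrite /y; field.
  rewrite !ln_div ?posrE ?mulr_gt0// lnM ?posrE//.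
  rewrite [X in `|X|](_ : _ = rho x * ((1 + y) * ln (1 + y) - y)); last by ring.
  have /andP[l0 lu] := xlnx_bound y1.
  rewrite ger0_norm ?mulr_ge0// mulrC ler_wpM2r// (le_trans lu)//.
  have -> : (e * C) ^+ 2 = (`|e| * C) ^+ 2.
    by rewrite !exprMn real_normK ?num_real.
  rewrite -(real_normK (num_real y)) lerXn2r ?nnegrE//.
  exact: le_trans yC.
have mV : measurable_fun setT (fun x => (rho_star x)^-1).
  rewrite (_ : (fun _ => _) = fun x => expR (- ln (rho_star x))).
    apply: measurableT_comp => //; apply: measurableT_comp => //.
    exact: measurableT_comp.
  by apply/funext => x; rewrite expRN lnK// posrE.
have mk : measurable_fun setT k.
  apply: measurable_funM => //; apply: measurableT_comp => //.
  exact: measurable_funM.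
have mp : measurable_fun setT p.
  apply: measurable_funM => //; apply: measurable_funD => //.
  by apply: measurable_funB; exact: measurableT_comp.
have mre : measurable_fun setT (fun x => rho x + e * h x).
  by apply: measurable_funD => //; exact: measurable_funM.
have mq : measurable_fun setT q.
  apply: measurable_funM => //; apply: measurableT_comp => //.
  exact: measurable_funM.
have mg : measurable_fun setT g.
  by apply: measurable_funB; [exact: measurable_funB|exact: measurable_funM].
have ip : mu.-integrable setT (EFin \o p).
  have iM : mu.-integrable setT
      (fun x => (`|C|)%:E * (`|(k x)%:E| + (rho x)%:E))%E.
    by apply: integrableZl => //; apply: integrableD => //; exact: integrable_abse.
  apply: le_integrable iM => //; first exact/measurable_EFinP.
  move=> x _ /=; rewrite lee_fin; have [r0|r0] := eqVneq (rho x) 0.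
    by rewrite /p h0// mul0r normr0.
  have rp : 0 < rho x by rewrite lt_neqAle eq_sym r0 rho0.
  rewrite [leRHS]ger0_norm ?mulr_ge0 ?addr_ge0//.
  rewrite /k /p ln_div ?posrE//; set l := ln (rho x) - ln _.
  rewrite !normrM (gtr0_norm rp).
  have -> : `|C| * (rho x * `|l| + rho x) = (`|C| * rho x) * (`|l| + 1) by ring.
  rewrite ler_pM//; first by rewrite (le_trans (hC x))// ler_wpM2r// ler_norm.
  by rewrite (le_trans (ler_normD _ _))// normr1.
have ig : mu.-integrable setT (EFin \o g).
  have iM : mu.-integrable setT (fun x => ((e * C) ^+ 2)%:E * (rho x)%:E)%E.
    exact: integrableZl.
  apply: le_integrable iM => //; first exact/measurable_EFinP.
  move=> x _ /=; rewrite lee_fin (le_trans (gb x))//.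
  by rewrite ger0_norm// mulr_ge0// sqr_ge0.
exists (\int[mu]_x g x).
  rewrite (le_trans (le_normr_Rintegral _ _))// -RintegralZl//.
  apply: le_Rintegral => //.
    exact: (integrable_norm ig).
  exact: (integrableZl _ _ irho).
have -> : (\int[mu]_x ((h x)%:E * KL_variation rho rho_star x) =
           \int[mu]_x (p x)%:E)%E by apply: eq_integral => x _; exact: pE.
have iep : mu.-integrable setT (fun x => e%:E * (p x)%:E)%E by exact: integrableZl.
have -> : KL mu (fun x => rho x + e * h x) rho_star =
          (\int[mu]_x ((k x)%:E + e%:E * (p x)%:E + (g x)%:E))%E.
  apply: eq_integral => x _; rewrite -EFinM -!EFinD; congr EFin.
  by rewrite /g /q; ring.
rewrite integralD//=; last exact: (integrableD _ iKL iep).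
rewrite integralD// integralZl// /Rintegral fineK//.
exact: integrable_fin_num.
Qed.

End KL_first_variation.

Section gradient_flow.
Context {R : realType}.

Definition msupport m (mu : set 'cV[R]_m -> \bar R) : set 'cV[R]_m :=
  [set u | forall e : R, 0 < e -> (0 < mu (ball u e))%E].

Definition gradient m (phi : 'cV[R]_m -> R) (u : 'cV[R]_m) : 'cV[R]_m :=
  \col_i 'D_(delta_mx i 0) phi u.

Definition divergence m (F : 'cV[R]_m -> 'cV[R]_m) (u : 'cV[R]_m) : R :=
  \sum_i 'D_(delta_mx i 0) (fun v => F v i 0) u.

Definition edifferentiable m (phi : 'cV[R]_m -> \bar R) (u : 'cV[R]_m) : Prop :=
  (\forall v \near u, phi v \is a fin_num) /\ differentiable (fine \o phi) u.

Definition mx_pinv m n (A : 'M[R]_(n, m)) : 'M[R]_(m, n) :=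
  invmx (A^T *m A) *m A^T.

(* Lebesgue measure of the column space of [V], as a measure on R^n carried by
   that subspace, when the columns of [V] are orthonormal. *)
Definition range_lebesgue m n (V : 'M[R]_(n, m)) : set 'cV[R]_n -> \bar R :=
  pushforward (lebesgue_cV m) (mulmx V).

Definition is_range_density m n (V : 'M[R]_(n, m))
    (nu : set 'cV[R]_n -> \bar R) (rho : 'cV[R]_n -> R) : Prop :=
  [/\ measurable_fun setT rho, (forall y, 0 <= rho y) &
    forall B, measurable B -> nu B = density_measure (range_lebesgue V) rho B].

Section flow.
Variables (m n : nat) (A V : 'M[R]_(n, m)) (rho_star : 'cV[R]_n -> R).
Implicit Types (rho_u : 'cV[R]_m -> R) (phi : 'cV[R]_m -> \bar R).

Definition pushforward_density rho_u (rho_y : 'cV[R]_n -> R) : Prop :=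
  is_range_density V
    (pushforward (density_measure (lebesgue_cV m) rho_u) (mulmx A)) rho_y.

(* [is_energy rho_u e] means [E rho_u = e]: the divergence is taken with respect
   to Lebesgue measure on the range of [A]. *)
Definition is_energy rho_u (e : \bar R) : Prop :=
  exists2 rho_y, pushforward_density rho_u rho_y &
    e = KL (range_lebesgue V) rho_y rho_star.

(* [phi] is the first variation of [E] at [rho_u]; it depends on the chosen
   version [rho_y] of the density, which is only determined almost everywhere. *)
Definition is_energy_variation rho_u phi : Prop :=
  exists2 rho_y, pushforward_density rho_u rho_y &
    forall u, phi u = KL_variation rho_y rho_star (A *m u).

Definition flux rho_u phi (u : 'cV[R]_m) : 'cV[R]_m :=
  rho_u u *: gradient (fine \o phi) u.

Definition is_gradient_flow (rho_u : R -> 'cV[R]_m -> R)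
    (phi : R -> 'cV[R]_m -> \bar R) : Prop := forall t, 0 < t ->
  [/\ prob_density (lebesgue_cV m) (rho_u t),
      is_energy_variation (rho_u t) (phi t),
      (forall u, msupport (density_measure (lebesgue_cV m) (rho_u t)) u ->
        edifferentiable (phi t) u) &
      forall u, [/\ derivable (rho_u ^~ u) t 1,
        (forall i, derivable (fun v => flux (rho_u t) (phi t) v i 0) u
                     (delta_mx i 0)) &
        'D_1 (rho_u ^~ u) t - divergence (flux (rho_u t) (phi t)) u = 0]].

Definition is_equilibrium rho_u : Prop :=
  exists2 phi, is_gradient_flow (fun=> rho_u) (fun=> phi) &
    forall u, msupport (density_measure (lebesgue_cV m) rho_u) u ->
      gradient (fine \o phi) u = 0.

End flow.

End gradient_flow.

(* Main.v *)
Require Import Defs.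
From HB Require Import structures.
From mathcomp Require Import all_boot all_order all_algebra.
From mathcomp Require Import all_classical all_reals all_analysis.
From mathcomp Require Import measurable_realfun.
From mathcomp Require Import ring lra.
Set Implicit Arguments.
Unset Strict Implicit.
Unset Printing Implicit Defensive.
Import Order.TTheory GRing.Theory Num.Theory.
Import numFieldNormedType.Exports.
Local Open Scope classical_set_scope.
Local Open Scope ring_scope.

(** Write [L] for the pseudo-inverse of [A], so that [L *m A = 1] and
    [A *m L = V *m V^T], and [rho_y] for the version of the density of the
    push-forward of [rho_u] from which the first variation [phi] is built.

    Equilibrium determines [rho_y].  Stationarity gives a vanishing gradient
    of [phi] on the support of [rho_u] only, so the main point is that this
    support is the whole space.  It is closed, and nonempty since [rho_u] has
    mass 1.  It is also open ([open_msupport]): near a point of the support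
    [phi] is finite, that is, [rho_y (A *m v) > 0]; a small ball around such
    a [v] is the preimage under [A] of a measurable set, so its mass is the
    integral of [rho_y] over that set, an integral of a positive function
    over a set with interior.  By connectedness [phi] is finite and
    differentiable everywhere with zero gradient, hence constant, which says
    that [rho_y] is proportional to [rho_star] on the range of [A]; there the
    factor [expR (f2 _)] is the constant [expR (f2 0)].

    The projection of [rho_star] is the marginal of a separable density.
    Integrating along the fibres of [V^T] ([integral_fibre]) shows that its
    density on the range is also proportional to [expR (f1 _)].  That lemma is
    the Fubini computation that proves Haar measure unique: translation
    invariance of Lebesgue measure determines the integral up to a constant.
    The two proportionality constants agree because both measures have
    mass 1. *)

(** * Measurability of affine maps on column vectors *)

Section measurable_linear.
Context {R : realType}.

Lemma measurable_mulmx p q (M : 'M[R]_(p, q)) :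
  measurable_fun [set: 'cV[R]_q] (mulmx M).
Proof.
apply/measurable_fun_cVP => i; under eq_fun do rewrite mxE.
apply: measurable_sum => j; apply: measurable_funM => //.
exact: (measurable_cV_coord j).
Qed.

Lemma measurable_cVD d (T : measurableType d) p (f g : T -> 'cV[R]_p) :
  measurable_fun [set: T] f -> measurable_fun [set: T] g ->
  measurable_fun [set: T] (fun t => f t + g t).
Proof.
move=> /measurable_fun_cVP mf /measurable_fun_cVP mg.
apply/measurable_fun_cVP => i; under eq_fun do rewrite mxE.
exact: measurable_funD.
Qed.

Lemma measurable_cVN d (T : measurableType d) p (f : T -> 'cV[R]_p) :
  measurable_fun [set: T] f -> measurable_fun [set: T] (fun t => - f t).
Proof.
move=> /measurable_fun_cVP mf.
apply/measurable_fun_cVP => i; under eq_fun do rewrite mxE.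
exact: measurableT_comp.
Qed.

Lemma measurable_cV_box p (A : 'I_p -> set R) : (forall i, measurable (A i)) ->
  measurable [set x : 'cV[R]_p | forall i, A i (x i 0)].
Proof.
move=> mA; rewrite (_ : [set x | _] =
    \bigcap_(i in [set: 'I_p]) (cV_coord i @^-1` A i)).
  apply: fin_bigcap_measurable => // i _.
  rewrite -[X in measurable X]setTI; exact: measurable_cV_coord.
by apply/seteqP; split=> x /= H i; [move=> _; exact: H|exact: H].
Qed.

End measurable_linear.

(** * Translation invariance of Lebesgue measure *)

Section translation.
Context {R : realType}.
Local Open Scope ereal_scope.

(** A translate of Lebesgue measure gives intervals their length, and Lebesgue
    measure is the only measure to do so. *)
Lemma ge0_integral_shift (f : R -> \bar R) (a : R) :
  measurable_fun setT f -> (forall x, 0 <= f x) ->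
  \int[lebesgue_measure]_x f (x + a)%R = \int[lebesgue_measure]_x f x.
Proof.
move=> mf f0.
have ms : measurable_fun setT (fun x : measurableTypeR R => (x + a)%R
    : measurableTypeR R).
  by apply: measurable_funD.
transitivity (\int[pushforward lebesgue_measure
    (fun x : measurableTypeR R => (x + a)%R : measurableTypeR R)]_x f x).
  by rewrite ge0_integral_pushforward.
apply: eq_measure_integral => //= B mB _; apply/esym.
apply: lebesgue_measure_unique => //= _ [[b c]] _ <-.
rewrite /pushforward /= (_ : _ @^-1` _ = `]b - a, c - a]%classic)%R.
  rewrite !lebesgue_measure_itv/= !lte_fin ltrD2r.
  by case: ifP => // _; rewrite -!EFinB; congr EFin; ring.
apply/seteqP; split=> x /=; rewrite !in_itv/= => /andP[? ?]; apply/andP; lra.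
Qed.

(** Lebesgue measure is built by adding one coordinate at a time, so Tonelli
    reduces a translation to its first coordinate and the remaining ones. *)
Lemma ge0_integral_cV_shift p (f : 'cV[R]_p -> \bar R) (a : 'cV[R]_p) :
  measurable_fun setT f -> (forall x, 0 <= f x) ->
  \int[lebesgue_cV p]_x f (x + a)%R = \int[lebesgue_cV p]_x f x.
Proof.
elim: p => [|p IH] in f a *; first by move=> _ _; apply: eq_integral => x _;
  congr f; apply/colP => -[].
move=> mf f0.
have mfa : measurable_fun setT (fun x : 'cV[R]_p.+1 => f (x + a)%R).
  by apply: (measurableT_comp mf); exact: measurable_cVD.
have cons_add (t : R) (x : 'cV[R]_p) : (cV_cons (t, x) + a = cV_cons
    (t + (cV_uncons a).1, x + (cV_uncons a).2))%R.
  by apply/colP => i; rewrite !mxE; case: unliftP => [j|] ->; rewrite /= ?mxE.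
rewrite /= /lebesgue_cV_step.
rewrite !ge0_integral_pushforward//; try exact: measurable_cV_cons.
rewrite preimage_setT.
have mc (g : 'cV[R]_p.+1 -> \bar R) : measurable_fun setT g ->
    measurable_fun setT (g \o @cV_cons R p).
  by move=> mg; apply: (measurableT_comp mg); exact: measurable_cV_cons.
rewrite !fubini_tonelli1//; try exact: mc; try by move=> ?; exact: f0.
rewrite /fubini_F /=.
set b := cV_uncons a.
transitivity (\int[lebesgue_measure]_t
   \int[lebesgue_cV p]_x f (cV_cons ((t + b.1)%R, x))).
  apply: eq_integral => t _.
  under eq_integral do rewrite cons_add.
  apply: (IH (fun x => f (cV_cons (t + b.1, x))))%R => //.
  apply: (measurableT_comp mf).
  by apply: (measurableT_comp (@measurable_cV_cons R p)).
apply: (@ge0_integral_shift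
  (fun t => \int[lebesgue_cV p]_x f (cV_cons (t, x)))).
  by apply: (@measurable_fun_fubini_tonelli_F _ _ _ _ _ _ (f \o @cV_cons R p));
    [exact: mc|move=> ?; exact: f0].
by move=> t; exact: integral_ge0.
Qed.

End translation.

(** * Integration along the fibres of a linear projection *)

Section fibres.
Context {R : realType} (m n : nat).
Variables (T : 'M[R]_(m, n)) (S : 'M[R]_(n, m)).
Hypothesis TS : T *m S = 1%:M.
Local Open Scope ereal_scope.

(** Let [e] be the indicator of the unit box, of mass 1.  Insert
    [e (z - T *m y)], whose integral in [z] is 1, exchange the two integrals,
    shift [y] by [S *m z], which turns [T *m y] into [T *m y + z],
    exchange again and shift [z] by [- (T *m y)]: the integral of [g] splits
    off, leaving [K], the integral of [h y * e (- (T *m y))].  Nothing forces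
    [h] to be integrable where [- (T *m y)] lies in the box, so [K] is an
    extended real. *)
Lemma integral_fibre (h : 'cV[R]_n -> \bar R) :
  measurable_fun setT h -> (forall y, 0 <= h y) ->
  (forall y z, h (y + S *m z)%R = h y) ->
  exists K, forall g : 'cV[R]_m -> \bar R,
    measurable_fun setT g -> (forall z, 0 <= g z) ->
    \int[lebesgue_cV n]_y (g (T *m y)%R * h y) =
    K * \int[lebesgue_cV m]_z g z.
Proof.
move=> mh h0 hS.
pose E : set 'cV[R]_m := [set x | forall i, `[0%R : R, 1%R]%classic (x i 0%R)].
have mE : measurable E.
  exact: (measurable_cV_box (A := fun=> `[0%R : R, 1%R]%classic)).
have E1 : lebesgue_cV m E = 1.
  rewrite (lebesgue_cV_box (A := fun=> `[0%R : R, 1%R]%classic))//.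
  by apply: big1 => i _; rewrite lebesgue_measure_itv/= lte_fin ltr01 sube0.
pose e (z : 'cV[R]_m) : \bar R := (\1_E z)%:E.
have me : measurable_fun setT e by apply/measurable_EFinP/measurable_indic.
have e0 z : 0 <= e z by rewrite lee_fin.
have ie (a : 'cV[R]_m) : \int[lebesgue_cV m]_z e (z + a)%R = 1.
  by rewrite ge0_integral_cV_shift// /e integral_indic ?setIT.
have mT : measurable_fun setT (mulmx T : 'cV[R]_n -> 'cV[R]_m).
  exact: measurable_mulmx.
have mp1 : measurable_fun setT (fun p : 'cV[R]_n * 'cV[R]_m => T *m p.1)%R.
  exact: (measurableT_comp mT measurable_fst).
exists (\int[lebesgue_cV n]_y (h y * e (- (T *m y))%R)) => g mg g0.
have meT : measurable_fun setT (fun y : 'cV[R]_n => e (- (T *m y))%R).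
  by apply: (measurableT_comp me); exact: measurable_cVN.
pose F (p : 'cV[R]_n * 'cV[R]_m) :=
  g (T *m p.1)%R * h p.1 * e (p.2 - T *m p.1)%R.
pose G (p : 'cV[R]_n * 'cV[R]_m) :=
  h p.1 * e (- (T *m p.1))%R * g (p.2 + T *m p.1)%R.
have mF : measurable_fun setT F.
  apply: emeasurable_funM.
    apply: emeasurable_funM; first exact: (measurableT_comp mg mp1).
    exact: (measurableT_comp mh measurable_fst).
  apply: (measurableT_comp me); apply: measurable_cVD => //.
  exact: measurable_cVN.
have mG : measurable_fun setT G.
  apply: emeasurable_funM.
    apply: emeasurable_funM; first exact: (measurableT_comp mh measurable_fst).
    exact: (measurableT_comp meT measurable_fst).
  by apply: (measurableT_comp mg); exact: measurable_cVD.
have F0 p : 0 <= F p by rewrite !mule_ge0.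
have G0 p : 0 <= G p by rewrite !mule_ge0.
transitivity (\int[lebesgue_cV n]_y \int[lebesgue_cV m]_z F (y, z)).
  apply: eq_integral => y _; rewrite /F/= ge0_integralZl//.
  - by rewrite ie mule1.
  - by apply: (measurableT_comp me); exact: measurable_cVD.
  - by rewrite mule_ge0.
rewrite fubini_tonelli//.
transitivity (\int[lebesgue_cV m]_z \int[lebesgue_cV n]_y G (y, z)).
  apply: eq_integral => z _.
  rewrite -(@ge0_integral_cV_shift _ _ (fun y => F (y, z)) (S *m z))//.
    apply: eq_integral => y _; rewrite /F /G/= hS mulmxDr mulmxA TS mul1mx.
    rewrite opprD [(- _ - _)%R]addrC addrA subrr sub0r.
    by rewrite [(z + _)%R]addrC -muleA muleC.
  exact: (measurableT_comp mF (measurable_pair2 _)).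
rewrite -fubini_tonelli//.
rewrite muleC -ge0_integralZl//; last 3 first.
- exact: emeasurable_funM.
- by move=> y _; rewrite mule_ge0.
- exact: integral_ge0.
apply: eq_integral => y _; rewrite /G/= ge0_integralZl//.
- by rewrite ge0_integral_cV_shift// muleC.
- by apply: (measurableT_comp mg); exact: measurable_cVD.
- by rewrite mule_ge0.
Qed.

End fibres.

(** * Supports and connectedness *)

Section support.
Context {R : realType}.

Lemma cV_ballE p (u : 'cV[R]_p) (e : R) : 0 < e ->
  ball u e = [set x | forall i, ball (u i 0) e (x i 0)].
Proof.
move=> e0; apply/seteqP; split=> x /=; first by move=> [_ H] i; exact: H.
by move=> H; split=> // i j; rewrite ord1; exact: H.
Qed.

Lemma measurable_cV_ball p (u : 'cV[R]_p) (e : R) : measurable (ball u e).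
Proof.
have [e0|e0] := leP e 0.
  by rewrite (_ : ball u e = set0) //; apply/seteqP; split=> // x [] /lt_geF;
    rewrite e0.
rewrite cV_ballE//; apply: (measurable_cV_box (A := fun i => ball (u i 0) e)).
by move=> i; exact: measurable_ball.
Qed.

Lemma lebesgue_cV_ball_gt0 p (u : 'cV[R]_p) (e : R) : 0 < e ->
  (0 < lebesgue_cV p (ball u e))%E.
Proof.
move=> e0; rewrite cV_ballE//.
rewrite (lebesgue_cV_box (A := fun i => ball (u i 0) e)); last first.
  by move=> i; exact: measurable_ball.
elim/big_ind : _ => //= [x y x0 y0|i _]; first by rewrite mule_gt0.
by rewrite lebesgue_measure_ball ?ltW// lte_fin mulrn_wgt0.
Qed.

Lemma rat_ball p (u : 'cV[R]_p) (e : R) : 0 < e ->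
  exists (q : 'cV[rat]_p) (r : rat),
    let B := ball (map_mx ratr q : 'cV[R]_p) (ratr r : R) in
    B u /\ B `<=` ball u e.
Proof.
move=> e0.
have /rat_in_itvoo[r] : 0 < e / 2 by rewrite divr_gt0.
rewrite in_itv/= => /andP[r0 re].
have q_ i : {q : rat | ball (u i 0) (ratr r) (ratr q : R)}.
  apply: cid; have /rat_in_itvoo[q] : u i 0 - ratr r < u i 0 + ratr r by lra.
  rewrite in_itv/= => /andP[? ?]; exists q.
  by rewrite /ball/= ltr_norml; apply/andP; split; lra.
exists (\col_i sval (q_ i)), r => /=.
have Bu : ball (map_mx ratr (\col_i sval (q_ i)) : 'cV[R]_p) (ratr r : R) u.
  split=> // i j; rewrite ord1 !mxE; exact/ball_sym/(svalP (q_ i)).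
split=> // x Bx; apply: (@le_ball _ _ _ (ratr r + ratr r)); first lra.
by apply: ball_triangle Bx; exact: ball_sym.
Qed.

(** Otherwise every point lies in a null ball with rational centre and radius,
    and these balls are countably many. *)
Lemma msupport_nonempty p (nu : {measure set 'cV[R]_p -> \bar R}) :
  nu setT != 0%E -> exists u, msupport nu u.
Proof.
move=> nuT; apply: contrapT => /forallNP noS; move/eqP: nuT; apply.
pose B (qr : 'cV[rat]_p * rat) : set 'cV[R]_p :=
  ball (map_mx ratr qr.1 : 'cV[R]_p) (ratr qr.2 : R).
pose F k := if unpickle k is Some qr then
  if nu (B qr) == 0%E then B qr else set0 else set0.
have negF k : nu.-negligible (F k).
  rewrite /F; case: unpickle => [qr|]; last exact: negligible_set0.
  case: ifPn => [/eqP nu0|_]; last exact: negligible_set0.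
  by apply/negligibleP => //; exact: measurable_cV_ball.
apply/negligibleP => //; apply: negligibleS (negligible_bigcup negF) => u _.
have [e [e0 nue]] : exists e : R, 0 < e /\ nu (ball u e) = 0%E.
  apply: contrapT => H; apply: (noS u) => e e0.
  rewrite lt0e measure_ge0 andbT; apply/eqP => nu0.
  by apply: H; exists e.
have [q [r [Bu Bue]]] := rat_ball u e0.
exists (pickle (q, r)) => //; rewrite /F pickleK.
rewrite [X in X == _](_ : _ = 0%E) ?eqxx//.
apply: (subset_measure0 _ _ Bue) => //; exact: measurable_cV_ball.
Qed.

Lemma closed_msupport p (nu : {measure set 'cV[R]_p -> \bar R}) :
  closed (msupport nu).
Proof.
move=> u clu e e0.
have e2 : 0 < e / 2 by rewrite divr_gt0.
have [v [Sv uv]] := clu _ (nbhsx_ballx u (e / 2) e2).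
apply: lt_le_trans (Sv _ e2) _; apply: le_measure;
  rewrite ?inE; try exact: measurable_cV_ball.
by move=> w vw; rewrite [e]splitr; exact: ball_triangle uv vw.
Qed.

(** A zero integral would make [f] vanish almost everywhere on [U]. *)
Lemma integral_gt0 d (T : measurableType d) (mu : {measure set T -> \bar R})
    (U : set T) (f : T -> R) :
  measurable U -> measurable_fun setT f -> (forall x, U x -> 0 < f x) ->
  (0 < mu U)%E -> (0 < \int[mu]_(x in U) (f x)%:E)%E.
Proof.
move=> mU mf f0 muU; rewrite lt0e; apply/andP; split; last first.
  by apply: integral_ge0 => x Ux; rewrite lee_fin ltW// f0.
apply/eqP => i0.
have : ae_eq mu U (EFin \o f) (cst 0%E).
  apply/ae_eq_integral_abs => //; first exact/measurable_EFinP/measurable_funTS.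
  rewrite -[RHS]i0; apply: eq_integral => x /[!inE] Ux.
  by rewrite gee0_abs// lee_fin ltW// f0.
move=> [N [mN N0 UN]]; move: muU; rewrite (subset_measure0 _ _ _ N0) ?ltxx//.
move=> x Ux; apply: UN => /= H; have := f0 _ Ux.
by have [->] := H Ux; rewrite ltxx.
Qed.

(** Along the segment from [u] to [v], parametrized by the connected real line,
    membership in [S] is a clopen condition. *)
Lemma clopen_full (V : normedModType R) (S : set V) (u v : V) :
  open S -> closed S -> S u -> S v.
Proof.
move=> oS cS Su.
pose path (t : R) := u + t *: (v - u).
have cpath : continuous path.
  move=> t; apply: cvgD; first exact: cvg_cst.
  apply: cvgZl; exact: cvg_id.
have : connected [set: R] by apply/connected_intervalP.
move=> /(_ (path @^-1` S)) H.
suff : (path @^-1` S) 1 by rewrite /path/= scale1r subrKC.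
rewrite H//.
- by exists 0; rewrite /path /= scale0r addr0.
- exists (path @^-1` S); last by rewrite setTI.
  by apply: open_comp => // t _; exact: cpath.
- exists (path @^-1` S); last by rewrite setTI.
  by apply: closed_comp => // t _; exact: cpath.
Qed.

(** The differential vanishes on the standard basis, hence on the direction of
    the segment from [u] to [v]; on that segment [f] has derivative zero. *)
Lemma gradient0_cst p (f : 'cV[R]_p -> R) :
  (forall u, differentiable f u) -> (forall u, gradient f u = 0) ->
  forall u v, f u = f v.
Proof.
move=> df g0 u v.
have d0 x w : 'd f x w = 0.
  rewrite (matrix_sum_delta w) linear_sum big1// => i _.
  rewrite big_ord1 linearZ/= -deriveE//.
  by have /colP/(_ i) := g0 x; rewrite !mxE => ->; rewrite scaler0.
pose path (t : R) := u + t *: (v - u).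
have dpath t : differentiable path t by [].
have := @is_derive_0_is_cst _ (f \o path) 0 1.
rewrite /= /path scale0r scale1r addr0 subrKC; apply => t.
have dfpath : differentiable (f \o path) t by exact: differentiable_comp.
apply: DeriveDef; first exact: diff_derivable.
rewrite (deriveE _ dfpath) (diff_comp (dpath t) (df _)); exact: d0.
Qed.

End support.

(** * Densities and their push-forwards *)

Section density.
Context {d} {T : measurableType d} {R : realType}.
Variables (mu : {measure set T -> \bar R}) (rho : T -> R).
Hypotheses (mrho : measurable_fun setT rho) (rho0 : forall x, 0 <= rho x).

(** Presents the density measure as a bundled measure, so that monotonicity and
    subadditivity apply to it. *)
Lemma density_is_measure :
  exists nu : {measure set T -> \bar R}, density_measure mu rho = nu.
Proof.
have nu0 : density_measure mu rho set0 = 0%E by exact: integral_set0.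
have nuge0 B : (0 <= density_measure mu rho B)%E.
  by apply: integral_ge0 => x _; rewrite lee_fin.
have nuS : semi_sigma_additive (density_measure mu rho).
  apply: semi_sigma_additive_nng_induced; first exact/measurable_EFinP.
  by move=> x; rewrite lee_fin.
pose M := isMeasure.Build _ _ _ (density_measure mu rho) nu0 nuge0 nuS.
pose nu : {measure set T -> \bar R} := HB.pack (density_measure mu rho) M.
by exists nu.
Qed.

End density.

Section range.
Context {R : realType} (m n : nat) (V : 'M[R]_(n, m)).

Lemma density_range (rho : 'cV[R]_n -> R) (B : set 'cV[R]_n) :
  measurable_fun setT rho -> (forall y, 0 <= rho y) -> measurable B ->
  density_measure (range_lebesgue V) rho B =
  (\int[lebesgue_cV m]_(z in mulmx V @^-1` B) (rho (V *m z))%:E)%E.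
Proof.
move=> mrho rho0 mB.
rewrite /density_measure /range_lebesgue ge0_integral_pushforward//.
- exact: measurable_mulmx.
- exact/measurable_funTS/measurable_EFinP.
- by move=> y _; rewrite lee_fin.
Qed.

End range.

(** * The support of an equilibrium *)

Section equilibrium.
Context {R : realType}.

(** A vanishing density makes the variation equal to [-oo]. *)
Lemma KL_variation_fin_num d (T : measurableType d) (rho rho_star : T -> R) x :
  0 <= rho x -> 0 < rho_star x ->
  KL_variation rho rho_star x \is a fin_num -> 0 < rho x.
Proof.
move=> rho0 star0; rewrite /KL_variation (lne_EFin star0).
move: rho0; rewrite le_eqVlt => /predU1P[<-|//].
by rewrite le0_lneNy.
Qed.

(** Solves the formula of the first variation for the density: a constant
    variation means that the two densities are proportional. *)
Lemma KL_variation_fine d (T : measurableType d) (rho rho_star : T -> R) x :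
  0 < rho x -> 0 < rho_star x ->
  rho x = expR (fine (KL_variation rho rho_star x) - 1) * rho_star x.
Proof.
move=> rho0 star0; rewrite /KL_variation !lne_EFin//= addrK expRD expRN.
by rewrite !lnK ?posrE// mulfVK// gt_eqF.
Qed.

Lemma continuous_mulmx p q (M : 'M[R]_(p, q)) :
  continuous (mulmx M : 'cV[R]_q -> 'cV[R]_p).
Proof.
move=> x B /nbhs_ballP[e /= e0 eB].
have : \forall y \near x, forall i, ball ((M *m x) i 0) e ((M *m y) i 0).
  apply: (@filter_forall _ _ _ (nbhs x) (nbhs_filter x)) => i.
  have : continuous (fun y : 'cV[R]_q => \sum_j M i j * y j 0).
    apply: continuous_big => // [|j _]; first exact: add_continuous.
    move=> y; apply: (@cvgMl_tmp _ _ (nbhs y) (nbhs_filter y)).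
    exact: coord_continuous.
  move=> /(_ x _ (nbhsx_ballx _ e e0)).
  by apply: (@filterS _ (nbhs x) (nbhs_filter x)) => y; rewrite /= !mxE.
apply: (@filterS _ (nbhs x) (nbhs_filter x)) => y H.
by apply: eB; split=> // i j; rewrite ord1.
Qed.

(** The mass that [rho_u] gives to a small ball [ball v r] is that of [B], the
    preimage of the ball by the left inverse [L], under the push-forward by [A];
    hence it is the integral of [rho_y] over the points of [B] in the range.
    In the coordinates given by [V] these points form a neighbourhood of
    [V^T *m (A *m v)], and [rho_y] is positive on them. *)
Lemma open_msupport m n (A V : 'M[R]_(n, m)) (L : 'M[R]_(m, n))
    (rho_u : 'cV[R]_m -> R) (rho_y : 'cV[R]_n -> R) :
  L *m A = 1%:M -> A *m L = V *m V^T -> V^T *m V = 1%:M ->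
  prob_density (lebesgue_cV m) rho_u -> pushforward_density A V rho_u rho_y ->
  (forall u, msupport (density_measure (lebesgue_cV m) rho_u) u ->
     \forall v \near u, 0 < rho_y (A *m v)) ->
  open (msupport (density_measure (lebesgue_cV m) rho_u)).
Proof.
move=> LA AL hV [mrho rho0 _] [my y0 yE] pos.
have [nu nuE] := density_is_measure (lebesgue_cV m) mrho rho0.
rewrite openE => u /pos /nbhs_ballP[e /= e0 ue].
apply/nbhs_ballP; exists e => //= v uv d d0.
have /nbhs_ballP[r /= r0 vr] : nbhs v (ball v d `&` ball u e).
  apply: filterI; first exact: nbhsx_ballx.
  apply: open_nbhs_nbhs; split => //; exact: ball_open.
have mL : measurable_fun setT (mulmx L : 'cV[R]_n -> 'cV[R]_m).
  exact: measurable_mulmx.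
pose B := mulmx L @^-1` ball v r.
have mB : measurable B.
  rewrite -[X in measurable X]setTI; apply: mL => //.
  exact: measurable_cV_ball.
have mVB : measurable (mulmx V @^-1` B).
  by rewrite -[X in measurable X]setTI; exact: measurable_mulmx.
have AB : mulmx A @^-1` B = ball v r.
  by apply/seteqP; split=> w; rewrite /B /= mulmxA LA mul1mx.
rewrite nuE; apply: (@lt_le_trans _ _ (nu (ball v r))); last first.
  apply: le_measure; rewrite ?inE; try exact: measurable_cV_ball.
  by move=> w /vr[].
rewrite -nuE -AB -[density_measure _ _ _]/(pushforward _ (mulmx A) B).
rewrite yE// density_range//.
apply: integral_gt0 => //.
- by apply: (measurableT_comp my); exact: measurable_mulmx.
- move=> z /= Bz; have -> : V *m z = A *m (L *m (V *m z)).
    by rewrite [RHS]mulmxA AL -mulmxA [V^T *m _]mulmxA hV mul1mx.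
  by apply: ue; have [] := vr _ Bz.
have : nbhs (V^T *m (A *m v)) (mulmx V @^-1` B).
  apply: (continuous_mulmx (M := V)).
  apply: (continuous_mulmx (M := L)).
  rewrite [V *m (V^T *m _)]mulmxA -AL -mulmxA !mulmxA LA mul1mx LA mul1mx.
  exact: nbhsx_ballx.
move=> /nbhs_ballP[s /= s0 sB].
apply: lt_le_trans (lebesgue_cV_ball_gt0 (V^T *m (A *m v)) s0) _.
by apply: le_measure => //; rewrite ?inE//; exact: measurable_cV_ball.
Qed.

End equilibrium.

(** * Projection of a separable density *)

Section separable.
Context {R : realType} (m n : nat) (V : 'M[R]_(n, m)).
Hypothesis hV : V^T *m V = 1%:M.
Variables (rho_star f1 f2 : 'cV[R]_n -> R).
Hypothesis hstar : prob_density (lebesgue_cV n) rho_star.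
Hypothesis hsep : forall y, rho_star y =
  expR (f1 (V *m V^T *m y)) * expR (f2 (y - V *m V^T *m y)).

Let VVV p (M : 'M[R]_(m, p)) : V *m V^T *m (V *m M) = V *m M.
Proof. by rewrite -mulmxA [V^T *m _]mulmxA hV mul1mx. Qed.

Lemma separable_range z :
  rho_star (V *m z) = expR (f1 (V *m z)) * expR (f2 0).
Proof. by rewrite hsep VVV subrr. Qed.

(** Restricting the measurable [rho_star] to the range isolates this factor, up
    to the constant [expR (f2 0)]. *)
Lemma measurable_range_factor :
  measurable_fun setT (fun y : 'cV[R]_n => expR (f1 (V *m V^T *m y))).
Proof.
have [mstar _ _] := hstar.
rewrite (_ : (fun y => _) = fun y : 'cV[R]_n =>
    rho_star (V *m V^T *m y) * (expR (f2 0))^-1).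
  apply: measurable_funM => //; apply: (measurableT_comp mstar).
  exact: measurable_mulmx.
apply/funext => y.
by rewrite -[V *m V^T *m y]mulmxA separable_range mulfK// gt_eqF// expR_gt0.
Qed.

Lemma measurable_orth_factor :
  measurable_fun setT (fun y : 'cV[R]_n => expR (f2 (y - V *m V^T *m y))).
Proof.
have [mstar _ _] := hstar.
rewrite (_ : (fun y => _) = fun y : 'cV[R]_n =>
    rho_star (y - V *m V^T *m y) * (expR (f1 0))^-1).
  apply: measurable_funM => //; apply: (measurableT_comp mstar).
  apply: measurable_cVD => //; apply: measurable_cVN; exact: measurable_mulmx.
apply/funext => y.
rewrite hsep mulmxBr -[V *m V^T *m y]mulmxA VVV subrr subr0.
by rewrite mulrC mulKf// gt_eqF// expR_gt0.
Qed.

(** Integration along the fibres of [V^T], applied to [g B], yields a constant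
    [K] in place of [c]; taking for [B] the whole space, where both sides have
    mass 1, forces [K = c]. *)
Lemma pushforward_separable (c : R) : 0 < c ->
  (\int[lebesgue_cV m]_z (c * expR (f1 (V *m z)))%:E = 1)%E ->
  forall B, measurable B ->
  pushforward (density_measure (lebesgue_cV n) rho_star) (mulmx (V *m V^T)) B =
  (\int[lebesgue_cV m]_(z in mulmx V @^-1` B) (c * expR (f1 (V *m z)))%:E)%E.
Proof.
move=> c0 c1.
have [_ _ star1] := hstar.
have mf1 : measurable_fun setT (fun z : 'cV[R]_m => expR (f1 (V *m z))).
  rewrite (_ : (fun z => _) = fun z => expR (f1 (V *m V^T *m (V *m z)))).
    apply: (measurableT_comp measurable_range_factor).
    exact: measurable_mulmx.
  by apply/funext => z; rewrite VVV.
pose h (y : 'cV[R]_n) := (expR (f2 (y - V *m V^T *m y)))%:E.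
have [| |y z|K KE] := integral_fibre hV (h := h).
- by apply/measurable_EFinP; exact: measurable_orth_factor.
- by move=> y; rewrite lee_fin expR_ge0.
- by rewrite /h mulmxDr VVV opprD addrACA subrr addr0.
pose g (B : set 'cV[R]_n) (z : 'cV[R]_m) :=
  (expR (f1 (V *m z)) * \1_B (V *m z))%:E.
have mV : measurable_fun setT (mulmx V : 'cV[R]_m -> 'cV[R]_n).
  exact: measurable_mulmx.
have gE B : measurable B ->
    pushforward (density_measure (lebesgue_cV n) rho_star)
      (mulmx (V *m V^T)) B = (K * \int[lebesgue_cV m]_z g B z)%E.
  move=> mB; rewrite -KE; last 2 first.
  - apply/measurable_EFinP/measurable_funM => //.
    by apply: (measurableT_comp _ mV); exact: measurable_indic.
  - by move=> z; rewrite lee_fin mulr_ge0.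
  rewrite /pushforward /density_measure integral_mkcond.
  apply: eq_integral => y _; rewrite /g /h mulmxA /patch -EFinM.
  rewrite indicE (_ : (y \in _) = (V *m V^T *m y \in B)); last first.
    by apply/idP/idP; rewrite !inE.
  by case: ifP => _; rewrite ?hsep ?mulr1// mulr0 mul0r.
have gI B : measurable B -> (\int[lebesgue_cV m]_(z in mulmx V @^-1` B)
    (c * expR (f1 (V *m z)))%:E = c%:E * \int[lebesgue_cV m]_z g B z)%E.
  move=> mB; rewrite -ge0_integralZl//; last 3 first.
  - apply/measurable_EFinP/measurable_funM => //.
    by apply: (measurableT_comp _ mV); exact: measurable_indic.
  - by move=> z; rewrite lee_fin mulr_ge0.
  - by rewrite lee_fin ltW.
  rewrite [LHS]integral_mkcond; apply: eq_integral => z _.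
  rewrite /g /patch -EFinM indicE (_ : (z \in _) = (V *m z \in B)); last first.
    by apply/idP/idP; rewrite !inE.
  by case: ifP => _; rewrite ?mulr1// !mulr0.
have Kc : K = c%:E.
  have := gI _ measurableT; rewrite preimage_setT c1 => I1.
  have := gE _ measurableT; rewrite /pushforward preimage_setT.
  rewrite /density_measure star1 => K1.
  by rewrite -[K]mule1 I1 muleCA -K1 mule1.
by move=> B mB; rewrite gE// gI// Kc.
Qed.

End separable.

(** * The equilibrium and the projected density *)

(** As [V] and [A] have the same column space, [A = V *m D^T] with [D] square;
    the rank condition makes [D] invertible, and [A^T *m A = D *m D^T] because
    the columns of [V] are orthonormal. *)
Lemma mx_pinvE (R : realType) m n (A V : 'M[R]_(n, m)) :
  \rank A = m -> V^T *m V = 1%:M -> (V^T == A^T)%MS ->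
  mx_pinv A *m A = 1%:M /\ A *m mx_pinv A = V *m V^T.
Proof.
move=> rA hV /andP[_ /submxP[D AE]].
have AV : A = V *m D^T by rewrite -[LHS]trmxK AE trmx_mul trmxK.
have Du : D^T \in unitmx.
  rewrite -row_full_unit /row_full eqn_leq rank_leq_col /=.
  by rewrite -{1}rA AV mxrankM_maxr.
have AA : A^T *m A = D *m D^T.
  by rewrite AV trmx_mul trmxK mulmxA -[D *m _ *m _]mulmxA hV mulmx1.
have AAu : D *m D^T \in unitmx by rewrite unitmx_mul Du -unitmx_tr Du.
have XD : invmx (D *m D^T) *m D *m D^T = 1%:M by rewrite -mulmxA mulVmx.
split; first by rewrite /mx_pinv AA -mulmxA AA mulVmx.
rewrite /mx_pinv AA AE {1}AV -!mulmxA; congr (V *m _).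
by rewrite !mulmxA -[D^T *m _ *m _]mulmxA (mulmx1C XD) mul1mx.
Qed.

Theorem theorem4p6 (R : realType) (m n : nat) (hmn : (m < n)%N)
    (A : 'M[R]_(n, m)) (hA : \rank A = m)
    (V : 'M[R]_(n, m)) (hV : V^T *m V = 1%:M) (hVA : (V^T == A^T)%MS)
    (rho_star : 'cV[R]_n -> R)
    (hstar : prob_density (lebesgue_cV n) rho_star)
    (f1 f2 : 'cV[R]_n -> R)
    (hsep : forall y, rho_star y =
      expR (f1 (V *m V^T *m y)) * expR (f2 (y - V *m V^T *m y)))
    (rho_u : 'cV[R]_m -> R) (hrho : is_equilibrium A V rho_star rho_u) :
  let rho_y := pushforward (density_measure (lebesgue_cV m) rho_u) (mulmx A) in
  (forall B : set 'cV[R]_n, measurable B ->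
     rho_y B = pushforward (density_measure (lebesgue_cV n) rho_star)
                 (mulmx (A *m mx_pinv A)) B) /\
  exists2 c : R, 0 < c &
    is_range_density V rho_y (fun y => c * expR (f1 (V *m V^T *m y))).
Proof.
move=> rho_y.
have [LA AL] := mx_pinvE hA hV hVA; rewrite AL; set L := mx_pinv A in LA AL.
have star_gt0 y : 0 < rho_star y by rewrite hsep mulr_gt0 ?expR_gt0.
have [phi flow grad0] := hrho.
(* The flow is constant in time, so any positive time will do. *)
have [prob [r hr phiE] dphi _] := flow 1 ltr01.
have [my r0 rE] := hr.
have [mrho rho0 rho1] := prob.
have [nu nuE] := density_is_measure (lebesgue_cV m) mrho rho0.
have full u : msupport (density_measure (lebesgue_cV m) rho_u) u.
  have [u0 Su0] : exists u, msupport nu u.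
    apply: msupport_nonempty.
    by rewrite -nuE /density_measure rho1 gt_eqF// lte01.
  apply: (clopen_full (u := u0)); last by rewrite nuE.
    apply: (open_msupport LA AL hV prob hr) => v /dphi[fin_phi _].
    apply: filterS fin_phi => w; rewrite phiE.
    exact: KL_variation_fin_num.
  by rewrite nuE; exact: closed_msupport.
have phi_cst u : fine (phi u) = fine (phi 0).
  apply: (gradient0_cst (f := fine \o phi)) => v.
    by have [] := dphi v (full v).
  exact: grad0.
pose c := expR (fine (phi 0) - 1) * expR (f2 0).
have c0 : 0 < c by rewrite mulr_gt0 ?expR_gt0.
have ALV z : A *m (L *m (V *m z)) = V *m z.
  by rewrite [LHS]mulmxA AL -mulmxA [V^T *m _]mulmxA hV mul1mx.
have rV z : r (V *m z) = c * expR (f1 (V *m z)).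
  pose u := L *m (V *m z); rewrite -{1}ALV -/u.
  have r_gt0 : 0 < r (A *m u).
    have [fin_phi _] := dphi u (full u); have := nbhs_singleton fin_phi.
    by rewrite phiE; exact: KL_variation_fin_num.
  rewrite (KL_variation_fine r_gt0 (star_gt0 _)) -phiE phi_cst.
  by rewrite /u ALV (separable_range hV hsep) /c mulrA mulrAC.
have rho_yE B : measurable B -> rho_y B =
    (\int[lebesgue_cV m]_(z in mulmx V @^-1` B) (c * expR (f1 (V *m z)))%:E)%E.
  move=> mB; rewrite /rho_y rE// density_range//.
  by apply: eq_integral => z _; rewrite rV.
split.
  move=> B mB; rewrite rho_yE//.
  rewrite (pushforward_separable hV hstar hsep (c := c))//.
  by rewrite -[RHS]rho1 -[LHS](rho_yE _ measurableT).
exists c => //.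
have mg := measurable_range_factor hV hstar hsep.
split.
- exact: measurable_funM.
- by move=> y; rewrite mulr_ge0// ltW.
- move=> B mB; rewrite rho_yE// density_range//.
  + apply: eq_integral => z _; congr (_ * expR (f1 _))%:E.
    by rewrite -mulmxA [V^T *m _]mulmxA hV mul1mx.
  + exact: measurable_funM.
  + by move=> y; rewrite mulr_ge0// ltW.
Qed.
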